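(* The frame reduct $\langle X;R\rangle$ of any S4 De Morgan spectral space $X$ is relationally isomorphic to the frame reduct $\langle\mathfrak{P}(\Omega(X));R_{\Omega(X)}\rangle$ of $\mathcal{S}_0(\mathcal{A}_0(X))$.
   Context: For a topological space $X$, $\Omega(X)$ is the set of compact open subsets of $X$, and the specialization order is: $x\leqslant y$ iff every open set containing $x$ contains $y$. A spectral space is a compact, $T_0$, sober space $X$ such that $\Omega(X)$ is closed under finite intersections and is a basis for $X$ (sober: every completely prime filter of the lattice of open sets is the set of open neighbourhoods of some point). Given $g\colon X\to X$ and $R\subseteq X\times X$, for $U\subseteq X$ put $U^*=\{x\in X: g(x)\notin U\}$ and $\nabla_R U=R[U]=\{y\in X:\exists x\in U,\ xRy\}$. An S4 De Morgan spectral space is $\langle X;g,R,\tau\rangle$ such that: (1) $\langle X;\tau\rangle$ is a spectral space; (2) $g\colon X\to X$ is an order-inverting involution with respect to $\leqslant$, and $R$ is reflexive and transitive; (3) if $U\in\Omega(X)$ then $U^*,\nabla_RU\in\Omega(X)$; (4) if not $xRy$, there is $U\in\Omega(X)$ with $x\in U$ and $y\notin\nabla_RU$. $\mathcal{A}_0(X)=\langle\Omega(X);\cap,\cup,{}^*,\emptyset,X,\nabla_R\rangle$, and $\mathcal{S}_0(\mathcal{A}_0(X))$ is its prime spectrum, whose underlying set $\mathfrak{P}(\Omega(X))$ is the set of prime (in particular proper) filters of the lattice $\Omega(X)$, with relation $\mathscr{X}R_{\Omega(X)}\mathscr{Y}$ iff for all $U\in\Omega(X)$, $U\in\mathscr{X}$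 implies $\nabla_RU\in\mathscr{Y}$. A relational isomorphism from $\langle X;R\rangle$ to $\langle X';R'\rangle$ is a bijection $f\colon X\to X'$ such that $xRy$ iff $f(x)R'f(y)$. *)

(* Defs.v *)
From HB Require Import structures.
From mathcomp Require Import all_boot all_order.
From mathcomp Require Import boolp classical_sets filter topology.

Set Implicit Arguments.
Unset Strict Implicit.
Unset Printing Implicit Defensive.

Local Open Scope classical_set_scope.

Record frame := Frame { world :> Type; accessible : world -> world -> Prop }.

Definition relationally_isomorphic (A B : frame) : Prop :=
  exists f : A -> B,
    bijective f /\ forall x y : A, accessible x y <-> accessible (f x) (f y).

Definition compact_opens (X : topologicalType) : set (set X) :=
  [set U | compact U /\ open U].

Definition specialization (X : topologicalType) (x y : X) : Prop :=
  forall U : set X, open U -> U x -> U y.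

(* Properness is the case [C = set0] of the last field. *)
Record completely_prime_filter (X : topologicalType) (F : set (set X)) : Prop :=
  CompletelyPrimeFilter {
    cpfilter_open : F `<=` open;
    cpfilterT : F setT;
    cpfilterI : forall U V, F U -> F V -> F (U `&` V);
    cpfilterS : forall U V, open V -> U `<=` V -> F U -> F V;
    cpfilter_prime : forall C : set (set X),
      C `<=` open -> F (\bigcup_(U in C) U) -> exists2 U, C U & F U }.

Definition sober (X : topologicalType) : Prop :=
  forall F : set (set X),
    completely_prime_filter F -> exists x : X, F = open_nbhs x.

HB.mixin Record Topological_isSpectral X of Topological X := {
  spectral_compact : compact [set: X];
  spectral_T0 : kolmogorov_space X;
  spectral_sober : sober X;
  compact_opensI : forall U V : set X,
    compact_opens U -> compact_opens V -> compact_opens (U `&` V);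
  compact_opens_basis : basis (@compact_opens X) }.

#[short(type="spectralType")]
HB.structure Definition Spectral :=
  {X of Topological X & Topological_isSpectral X}.

Definition set_star T (g : T -> T) (U : set T) : set T := [set x | ~ U (g x)].

Definition set_nabla T (R : T -> T -> Prop) (U : set T) : set T :=
  [set y | exists2 x, U x & R x y].

HB.mixin Record Spectral_isS4DeMorgan X of Spectral X := {
  dm_inv : X -> X;
  dm_rel : X -> X -> Prop;
  dm_invK : involutive dm_inv;
  dm_inv_anti : forall x y : X,
    specialization x y -> specialization (dm_inv y) (dm_inv x);
  dm_rel_refl : forall x, dm_rel x x;
  dm_rel_trans : forall x y z, dm_rel x y -> dm_rel y z -> dm_rel x z;
  compact_opens_star : forall U : set X,
    compact_opens U -> compact_opens (set_star dm_inv U);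
  compact_opens_nabla : forall U : set X,
    compact_opens U -> compact_opens (set_nabla dm_rel U);
  dm_rel_sep : forall x y, ~ dm_rel x y ->
    exists U : set X, [/\ compact_opens U, U x & ~ set_nabla dm_rel U y] }.

#[short(type="s4dmSpectralType")]
HB.structure Definition S4DeMorganSpectral :=
  {X of Spectral X & Spectral_isS4DeMorgan X}.

Definition frame_reduct (X : s4dmSpectralType) : frame := @Frame X dm_rel.

Record modal_algebra := ModalAlgebra {
  alg_display : Order.disp_t;
  alg_lattice :> tbDistrLatticeType alg_display;
  alg_neg : alg_lattice -> alg_lattice;
  alg_nabla : alg_lattice -> alg_lattice }.

Record prime_filter d (L : tbLatticeType d) (F : set L) : Prop := PrimeFilter {
  prime_filterT : F \top%O;
  prime_filterI : forall a b, F a -> F b -> F (a `&` b)%O;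
  prime_filterS : forall a b, (a <= b)%O -> F a -> F b;
  prime_filter_proper : ~ F \bot%O;
  prime_filter_prime : forall a b, F (a `|` b)%O -> F a \/ F b }.

(* The frame reduct of the prime spectrum of [A]; the involution and the
   topology of the spectrum play no role in it. *)
Definition spectrum_frame (A : modal_algebra) : frame :=
  @Frame {F : set A | prime_filter F}
    (fun F G => forall a : A, sval F a -> sval G (alg_nabla a)).

Definition Omega (X : spectralType) : Type :=
  {U : set X | U \in @compact_opens X}.

HB.instance Definition _ (X : spectralType) := SubChoice.on (Omega X).

Fact compact_opens_meet (X : spectralType) (U V : set X) :
  U \in @compact_opens X -> V \in @compact_opens X ->
  (U `&` V)%O \in @compact_opens X.
Proof. by rewrite !inE; exact: compact_opensI. Qed.

Fact compact_opens_join (X : spectralType) (U V : set X) :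
  U \in @compact_opens X -> V \in @compact_opens X ->
  (U `|` V)%O \in @compact_opens X.
Proof.
by rewrite !inE => -[cU oU] [cV oV]; split; [exact: compactU|exact: openU].
Qed.

Fact compact_opens_bot (X : spectralType) :
  (\bot%O : set X) \in @compact_opens X.
Proof. by rewrite inE; split; [exact: compact0|exact: open0]. Qed.

Fact compact_opens_top (X : spectralType) :
  (\top%O : set X) \in @compact_opens X.
Proof. by rewrite inE; split; [exact: spectral_compact|exact: openT]. Qed.

HB.instance Definition _ (X : spectralType) :=
  Order.SubChoice_isTBSubLattice.Build _ (set X)
    (fun U => U \in @compact_opens X) set_display (Omega X)
    (@compact_opens_meet X) (@compact_opens_join X)
    (@compact_opens_bot X) (@compact_opens_top X).

Fact Omega_meetUl (X : spectralType) :
  @left_distributive (Omega X) (Omega X) Order.meet Order.join.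
Proof. by move=> U V W; apply: val_inj; exact: setIUl. Qed.

HB.instance Definition _ (X : spectralType) :=
  Order.Lattice_Meet_isDistrLattice.Build _ (Omega X) (@Omega_meetUl X).

Definition Omega_star (X : s4dmSpectralType) (U : Omega X) : Omega X :=
  exist _ (set_star dm_inv (val U))
    (mem_set (compact_opens_star _ (set_mem (valP U)))).

Definition Omega_nabla (X : s4dmSpectralType) (U : Omega X) : Omega X :=
  exist _ (set_nabla dm_rel (val U))
    (mem_set (compact_opens_nabla _ (set_mem (valP U)))).

Definition compact_open_algebra (X : s4dmSpectralType) : modal_algebra :=
  @ModalAlgebra _ (Omega X) (@Omega_star X) (@Omega_nabla X).

(* Main.v *)
Require Import Defs.
From mathcomp Require Import all_boot all_order.
From mathcomp Require Import boolp classical_sets functions filter topology.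

Set Implicit Arguments.
Unset Strict Implicit.
Unset Printing Implicit Defensive.

Import Order.TTheory.

Local Open Scope classical_set_scope.

(* The isomorphism sends x to its compact open neighbourhoods. A prime filter P
   of compact opens generates a filter F of opens; once F is known to be
   completely prime, sobriety makes it the neighbourhood filter of a point.
   For complete primality, let U in P be covered by opens outside F. Then the
   compact opens outside P cover U, and by primality of P they are directed, so
   by compactness a single one of them contains U, contradicting upward closure
   of P. *)

Lemma Omega_leP (X : spectralType) (U V : Omega X) :
  (U <= V)%O <-> val U `<=` val V.
Proof. by rewrite -Order.le_val; split=> /subsetPset. Qed.

Definition Omega_of (X : spectralType) (U : set X) (cU : compact_opens U) :
  Omega X := exist _ U (mem_set cU).

Lemma Omega_compact_open (X : spectralType) (U : Omega X) :
  compact_opens (val U).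
Proof. exact: set_mem (valP U). Qed.

Lemma Omega_basis (X : spectralType) (V : set X) (x : X) :
  nbhs x V -> exists2 U : Omega X, val U x & val U `<=` V.
Proof.
case: (@compact_opens_basis X) => _ /(_ x) basisx /basisx [U [cU Ux] UV].
by exists (Omega_of cU).
Qed.

(** Compactness enters as the near-covering property, applied to the filter generated by the tails
    of the family, ordered by inclusion: each point of [K] has a neighbourhood lying in every [W j]
    of some tail, so a single tail serves all of [K]. *)
Lemma compact_directed_cover (X : topologicalType) (I : Type) (D : set I)
    (W : I -> set X) (K : set X) :
  compact K -> D !=set0 ->
  (forall i j, D i -> D j -> exists k, [/\ D k, W i `<=` W k & W j `<=` W k]) ->
  (forall i, D i -> open (W i)) ->
  K `<=` \bigcup_(i in D) W i -> exists2 i, D i & K `<=` W i.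
Proof.
move=> /compact_near_coveringP nK [i0 Di0] dirW oW KW.
pose tails : set_system I :=
  [set A | exists2 i, D i & forall j, D j -> W i `<=` W j -> A j].
have Ftails : Filter tails.
  split.
  - by exists i0.
  - move=> A B [i Di iA] [j Dj jB]; have [k [Dk ik jk]] := dirW _ _ Di Dj.
    by exists k => // l Dl kl; split; [apply: iA|apply: jB] => // x;
      [move=> /ik/kl|move=> /jk/kl].
  - by move=> A B AB [i Di iA]; exists i => // j Dj ij; exact: AB (iA _ Dj ij).
have [x Kx|i Di iK] := nK I tails (fun i => W i) Ftails.
  have [i Di Wix] := KW x Kx.
  exists (W i, [set j | D j /\ W i `<=` W j]) => /=.
    by split; [exact: open_nbhs_nbhs (conj (oW i Di) Wix)|exists i].
  by move=> [y j] /= [Wiy [_ ij]]; exact: ij.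
(* The index [i] lies in its own tail. *)
by exists i => //; exact: iK.
Qed.

Lemma open_generated_completely_prime (X : spectralType) (P : set (Omega X)) :
  prime_filter P ->
  completely_prime_filter
    [set V : set X | open V /\ exists2 U : Omega X, P U & val U `<=` V].
Proof.
move=> [PT PI PS Pbot Pprime]; split.
- by move=> V [].
- by split; [exact: openT|exists \top%O].
- move=> V W [oV [U PU UV]] [oW [U' PU' UW]]; split; first exact: openI.
  exists (U `&` U')%O; first exact: PI.
  by move=> x [/UV Vx /UW].
- by move=> V W oW VW [_ [U PU UV]]; split=> //; exists U => // x /UV/VW.
move=> C oC [_ [U PU UC]]; apply: contrapT => noC.
have notP (W : Omega X) V : C V -> val W `<=` V -> ~ P W.
  by move=> CV WV PW; apply: noC; exists V => //; split; [exact: oC|exists W].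
(* The directed family is the complement of [P]: properness puts [\bot%O] in it, and primality
   closes it under joins. *)
have [|||i||W nPW UW] :=
  @compact_directed_cover X (Omega X) (~` P) val (val U).
- by have [] := Omega_compact_open U.
- by exists \bot%O.
- move=> V W nPV nPW; exists (V `|` W)%O; split.
  + by move=> /Pprime [].
  + by apply/Omega_leP; exact: leUl.
  + by apply/Omega_leP; exact: leUr.
- by have [] := Omega_compact_open i.
- move=> x /UC [V CV Vx].
  have [W Wx WV] := Omega_basis (open_nbhs_nbhs (conj (oC _ CV) Vx)).
  by exists W => //; exact: notP WV.
by apply: nPW; apply: PS PU; apply/Omega_leP.
Qed.

Lemma prime_filter_point (X : spectralType) (P : set (Omega X)) :
  prime_filter P -> exists x : X, P = [set U : Omega X | val U x].
Proof.
move=> primeP.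
have [x Fx] := spectral_sober _ (open_generated_completely_prime primeP).
exists x; apply/seteqP; split=> U.
  move=> PU; have [_ oU] := Omega_compact_open U.
  suff : open_nbhs x (val U) by case.
  by rewrite -Fx; split=> //; exists U.
move=> /= Ux; have [_ oU] := Omega_compact_open U.
have : open_nbhs x (val U) by [].
(* Read in the generated filter, the neighbourhood [val U] of [x] contains some [V] in [P], which
   forces [U] into [P]. *)
rewrite -Fx => -[_ [V PV VU]].
by apply: prime_filterS PV => //; apply/Omega_leP.
Qed.

Lemma point_prime_filter (X : spectralType) (x : X) :
  prime_filter [set U : Omega X | val U x].
Proof. by split=> // U V /Omega_leP UV /UV. Qed.

(** Injectivity of the isomorphism: the T0 axiom gives a neighbourhood of one point missing the
    other, and the basis shrinks it to a compact open set. *)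
Lemma Omega_separates (X : spectralType) (x y : X) :
  [set U : Omega X | val U x] = [set U : Omega X | val U y] -> x = y.
Proof.
move=> xy; apply/eqP; apply: contrapT => /negP /spectral_T0 [A].
rewrite !in_setE => -[] [/Omega_basis [U Ux UA]]; apply;
  apply: UA.
- by have : [set U : Omega X | val U x] U by []; rewrite xy.
- by have : [set U : Omega X | val U y] U by []; rewrite -xy.
Qed.

Theorem theorem3p15 (X : s4dmSpectralType) :
  relationally_isomorphic (frame_reduct X)
    (spectrum_frame (compact_open_algebra X)).
Proof.
exists (fun x : X => exist _ _ (point_prime_filter x)); split.
  rewrite -setTT_bijective; split=> //.
  - by move=> x y _ _ [] /Omega_separates.
  - move=> [P primeP] _; have [x Px] := prime_filter_point primeP.
    by exists x => //; exact: eq_exist.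
(* Forwards, [x] itself witnesses that [y] lies in the image of [U]; backwards, the separation axiom
   [dm_rel_sep] is contraposed. *)
move=> x y; split=> [xRy U Ux|xRy]; first by exists x.
apply: contrapT => /dm_rel_sep [U [cU Ux nUy]].
exact: nUy (xRy (Omega_of cU) Ux).
Qed.
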